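(* Let $c_0,d_0>0$ be a pair of Bourgain–Tzafriri constants (as defined in the context). Let $n\in\mathbb{N}$, $n\ge 1$, and let $A:\mathbb{R}\to M_{n\times n}$ be a continuous matrix function such that for all $t\in\mathbb{R}$, $\|A(t)e_i\|=1$ for every $1\le i\le n$. Let $\Lambda=\sup_{t\in\mathbb{R}}\|A(t)\|$ and let $\gamma\in(0,1)$. Then there exist an integer $m\ge \dfrac{d_0 n}{7\Lambda^2}$ and a continuous family $\{U(t)\}_{t\in\mathbb{R}}$ of $m$-dimensional subspaces of $\mathbb{R}^n$ such that for every $t\in\mathbb{R}$ and every $v\in U(t)$, $\|A(t)v\|\ge \gamma c_0\|v\|$.
   Context: $M_{m\times n}$ denotes the space of real $m\times n$ matrices; $e_1,\dots,e_n$ is the standard basis of $\mathbb{R}^n$; $\|\cdot\|$ on vectors is the Euclidean norm and on matrices the operator norm $\|A\|=\sup\{\|Ax\|:\|x\|=1\}$. A matrix function is continuous if its entries are continuous. A pair of Bourgain–Tzafriri constants is a pair of universal constants $c_0,d_0>0$ with the following property (such a pair exists by a theorem of Bourgain and Tzafriri): for every $n\ge1$ and every $A\in M_{n\times n}$ with $\|Ae_i\|=1$ for $1\le i\le n$, there exists $\sigma\subset\{1,\dots,n\}$ with $|\sigma|\ge d_0 n\|A\|^{-2}$ such that for all real scalars $(a_j)_{j\in\sigma}$, $\big\|\sum_{j\in\sigma}a_jAe_j\big\|\ge c_0\big(\sum_{j\in\sigma}|a_j|^2\big)^{1/2}$. For an interval $I\subset\mathbb{R}$, a family $\{U(t)\}_{t\in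 I}$ of subspaces of $\mathbb{R}^n$ is continuous if the function $P:I\to M_{n\times n}$, where $P(t)$ is the orthogonal projection onto $U(t)$, is continuous. *)

(* Defs.v *)
From HB Require Import structures.
From mathcomp Require Import all_boot all_order all_algebra.
From mathcomp Require Import all_classical all_reals.
From mathcomp Require Import topology normedtype.
Set Implicit Arguments.
Unset Strict Implicit.
Unset Printing Implicit Defensive.
Import Order.TTheory GRing.Theory Num.Theory.
Import numFieldNormedType.Exports.
Local Open Scope classical_set_scope.
Local Open Scope ring_scope.

Definition stdbasis (R : realType) (n : nat) (i : 'I_n) : 'cV[R]_n :=
  delta_mx i 0.

Definition dotv (R : realType) (n : nat) (u v : 'cV[R]_n) : R :=
  \sum_(i < n) u i 0 * v i 0.

(* The library norm on matrices is the max norm, hence this definition. *)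
Definition enorm (R : realType) (n : nat) (v : 'cV[R]_n) : R :=
  Num.sqrt (dotv v v).

(* A real-valued [sup]: the set is bounded, and it is nonempty for n >= 1. *)
Definition opnorm (R : realType) (n : nat) (A : 'M[R]_n) : R :=
  sup [set enorm (A *m x) | x in [set x : 'cV[R]_n | enorm x = 1]].

Definition BT_constants (R : realType) (c0 d0 : R) : Prop :=
  [/\ 0 < c0, 0 < d0 &
    forall (n : nat) (A : 'M[R]_n), (1 <= n)%N ->
      (forall i : 'I_n, enorm (A *m stdbasis R i) = 1) ->
      exists sigma : {set 'I_n},
        d0 * n%:R * opnorm A ^- 2 <= #|sigma|%:R /\
        forall a : 'I_n -> R,
          c0 * Num.sqrt (\sum_(j in sigma) `|a j| ^+ 2)
            <= enorm (\sum_(j in sigma) a j *: (A *m stdbasis R j))].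

Definition mx_continuous (R : realType) (n : nat) (A : R -> 'M[R]_n) : Prop :=
  forall i j : 'I_n, continuous (fun t : R => A t i j).

Definition is_orthoproj (R : realType) (n : nat)
    (P : 'M[R]_n) (U : {vspace 'cV[R]_n}) : Prop :=
  forall x : 'cV[R]_n,
    P *m x \in U /\ forall u, u \in U -> dotv (x - P *m x) u = 0.

(* The orthogonal projection onto a subspace exists and is unique, so P below
   is the function sending t to the orthogonal projection onto U t. *)
Definition continuous_family (R : realType) (n : nat)
    (U : R -> {vspace 'cV[R]_n}) : Prop :=
  exists P : R -> 'M[R]_n,
    (forall t, is_orthoproj (P t) (U t)) /\ mx_continuous P.

(* Main.v *)
Require Import Defs.
From mathcomp Require Import all_boot all_order all_algebra.
From mathcomp Require Import all_classical all_reals.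
From mathcomp Require Import topology normedtype.
From mathcomp Require Import ring lra.
Import Order.TTheory GRing.Theory Num.Theory.
Import numFieldNormedType.Exports.
Local Open Scope classical_set_scope.
Local Open Scope ring_scope.

(** Let H(t) = A(t)^T A(t) - (gamma c0)^2. It suffices to find a continuous
    n x m matrix F(t) with F(t)^T H(t) F(t) positive definite for every t: the
    column space of F(t) is then the required subspace, with orthogonal
    projection F (F^T F)^-1 F^T. Take m to be the least cardinality of the
    Bourgain-Tzafriri sets sigma(t); then at each t0 some coordinate inclusion W
    of R^m works for all t near t0. Any F that works at a time s near t0 is moved
    into the range of W as follows: there is an invertible C such that
    (F^T H(s) W) C is positive semidefinite, hence the segment from F to W C
    consists of matrices that work at time s, and, by openness, it can be run
    through in a short time interval around s. Frames therefore extend over a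
    neighbourhood of every t0, and such extensions are glued over the whole
    line. This yields m >= d0 n / Lambda^2, without the factor 7. *)

(** * Euclidean inner product *)

Lemma dotvE {R : realType} {n} (u v : 'cV[R]_n) : dotv u v = (u^T *m v) 0 0.
Proof. by rewrite mxE; apply: eq_bigr => i _; rewrite mxE. Qed.

Lemma dotv_ge0 {R : realType} {n} (u : 'cV[R]_n) : 0 <= dotv u u.
Proof. by apply: sumr_ge0 => i _; rewrite -expr2 sqr_ge0. Qed.

Lemma dotv_eq0 {R : realType} {n} (u : 'cV[R]_n) : (dotv u u == 0) = (u == 0).
Proof.
apply/idP/eqP => [|->]; last by rewrite /dotv big1 // => i _; rewrite mxE mul0r.
rewrite psumr_eq0 => [/allP u0|i _]; last by rewrite -expr2 sqr_ge0.
apply/matrixP => i j; rewrite ord1 mxE; apply/eqP.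
by have := u0 i (mem_index_enum i); rewrite /= -expr2 sqrf_eq0.
Qed.

Lemma dotv_mulmx {R : realType} {n m} (B : 'M[R]_(n, m)) u v :
  dotv u (B *m v) = dotv (B^T *m u) v.
Proof. by rewrite !dotvE trmx_mul trmxK mulmxA. Qed.

Lemma dotvDr {R : realType} {n} (u v w : 'cV[R]_n) :
  dotv u (v + w) = dotv u v + dotv u w.
Proof. by rewrite !dotvE mulmxDr mxE. Qed.

Lemma dotvBr {R : realType} {n} (u v w : 'cV[R]_n) :
  dotv u (v - w) = dotv u v - dotv u w.
Proof. by rewrite !dotvE mulmxBr !mxE. Qed.

Lemma dotvZr {R : realType} {n} (a : R) (u v : 'cV[R]_n) :
  dotv u (a *: v) = a * dotv u v.
Proof. by rewrite !dotvE -scalemxAr mxE. Qed.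

Lemma dotvC {R : realType} {n} (u v : 'cV[R]_n) : dotv u v = dotv v u.
Proof. by apply: eq_bigr => i _; rewrite mulrC. Qed.

Lemma sqr_enorm {R : realType} {n} (u : 'cV[R]_n) : enorm u ^+ 2 = dotv u u.
Proof. by rewrite sqr_sqrtr ?dotv_ge0. Qed.

Lemma enorm_ge0 {R : realType} {n} (u : 'cV[R]_n) : 0 <= enorm u.
Proof. exact: sqrtr_ge0. Qed.

(** * Quadratic forms and positive definiteness *)

Definition norm1 {R : realType} {n m} (K : 'M[R]_(n, m)) : R :=
  \sum_i \sum_j `|K i j|.

Lemma norm1_ge0 {R : realType} {n m} (K : 'M[R]_(n, m)) : 0 <= norm1 K.
Proof. by do 2!apply: sumr_ge0 => ? _. Qed.

Lemma coord_sqr_le {R : realType} {n} (x : 'cV[R]_n) i :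
  x i 0 ^+ 2 <= dotv x x.
Proof.
rewrite /dotv (bigD1 i) //= expr2 lerDl.
by apply: sumr_ge0 => j _; rewrite -expr2 sqr_ge0.
Qed.

(** Each product [x i 0 * x j 0] is at most [dotv x x] in absolute value, since both squares are. *)
Lemma quad_form_le {R : realType} {n} (K : 'M[R]_n) x :
  `|dotv x (K *m x)| <= norm1 K * dotv x x.
Proof.
rewrite /norm1 mulr_suml; apply: (le_trans (ler_norm_sum _ _ _)).
apply: ler_sum => i _; rewrite mxE mulr_sumr mulr_suml.
apply: (le_trans (ler_norm_sum _ _ _)); apply: ler_sum => j _.
have := coord_sqr_le x i; have := coord_sqr_le x j.
rewrite !normrM mulrCA => hj hi; apply: ler_wpM2l => //.
rewrite -normrM ler_norml; apply/andP; split; nra.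
Qed.

(** The uniform constant [d] makes openness immediate, with no compactness of the sphere. Symmetry
    of [K] is not part of the definition. *)
Definition pos_def {R : realType} {m} (K : 'M[R]_m) : Prop :=
  exists2 d : R, 0 < d & forall x, d * dotv x x <= dotv x (K *m x).

Lemma pos_def_ker {R : realType} {m} {K : 'M[R]_m} {x} :
  pos_def K -> dotv x (K *m x) <= 0 -> x = 0.
Proof.
move=> [d d0 Kd] xK; apply/eqP; rewrite -dotv_eq0 eq_le dotv_ge0 andbT.
by rewrite -(pmulr_rle0 _ d0) (le_trans (Kd x)).
Qed.

Lemma unitmx_ker0 {R : realType} {m} {K : 'M[R]_m} :
  (forall x : 'cV_m, K *m x = 0 -> x = 0) -> K \in unitmx.
Proof.
move=> K0; rewrite -unitmx_tr -row_free_unit -kermx_eq0.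
apply/eqP/row_matrixP => i; rewrite row0; apply: trmx_inj; rewrite trmx0.
apply: K0; rewrite -{1}[K]trmxK -trmx_mul -row_mul mulmx_ker row0.
by rewrite trmx0.
Qed.

Lemma pos_def_congr {R : realType} {m} {K : 'M[R]_m} {C : 'M[R]_m} :
  C \in unitmx -> pos_def K -> pos_def (C^T *m K *m C).
Proof.
(* Since [x = D *m (C *m x)], [dotv x x] is at most [k] times [dotv (C *m x) (C *m x)]. The added 1
   keeps [k] positive, also for [m = 0]. *)
move=> Cu [d d0 Kd]; set D := invmx C; set k := norm1 (D^T *m D) + 1.
have k0 : 0 < k by rewrite ltr_wpDl ?norm1_ge0.
exists (d / k) => [|x]; first exact: divr_gt0.
rewrite -!mulmxA dotv_mulmx trmxK; apply: le_trans (Kd _).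
rewrite -mulrA ler_pM2l // mulrC ler_pdivrMr // mulrC.
have -> : dotv x x = dotv (C *m x) ((D^T *m D) *m (C *m x)).
  by rewrite -mulmxA dotv_mulmx trmxK !mulmxA mulVmx // mul1mx.
apply: le_trans (le_trans (ler_norm _) (quad_form_le _ _)) _.
by rewrite ler_wpM2r ?dotv_ge0 // lerDl.
Qed.

(* Gaussian elimination [M = L pid_r V] makes [M *m C = L pid_r L^T]
   positive semidefinite for the invertible [C = V^-1 L^T]. *)
Lemma ex_unit_psd {R : realType} {m} (M : 'M[R]_m) :
  exists2 C : 'M[R]_m, C \in unitmx & forall x, 0 <= dotv x (M *m C *m x).
Proof.
pose L := col_ebase M; pose V := row_ebase M.
exists (invmx V *m L^T) => [|x].
  by rewrite unitmx_mul unitmx_inv row_ebase_unit unitmx_tr col_ebase_unit.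
pose p : 'M[R]_m := pid_mx (\rank M).
have pp : p *m p = p by rewrite pid_mx_id // rank_leq_row.
have -> : M *m (invmx V *m L^T) = (p *m L^T)^T *m (p *m L^T).
  rewrite -{1}(mulmx_ebase M) -/L -/V -/p trmx_mul trmxK tr_pid_mx.
  rewrite !mulmxA -(mulmxA L p p) pp.
  by rewrite -(mulmxA (L *m p)) mulmxV ?row_ebase_unit // mulmx1.
by rewrite -mulmxA dotv_mulmx trmxK dotv_ge0.
Qed.

(** * Entrywise continuity of matrix functions *)

Definition entry_continuous {R : realType} {n m} (F : R -> 'M[R]_(n, m)) : Prop :=
  forall i j, continuous (fun t => F t i j).

Lemma continuous_sum {R : realType} {I : Type} (r : seq I) (P : pred I)
    (f : I -> R -> R) : (forall i, P i -> continuous (f i)) ->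
  continuous (fun t => \sum_(i <- r | P i) f i t).
Proof. by apply: continuous_big; exact: (@add_continuous R^o). Qed.

Lemma continuous_prod {R : realType} {I : Type} (r : seq I) (P : pred I)
    (f : I -> R -> R) : (forall i, P i -> continuous (f i)) ->
  continuous (fun t => \prod_(i <- r | P i) f i t).
Proof. by apply: continuous_big; exact: mul_continuous. Qed.

Lemma entry_continuous_cst {R : realType} {n m} (F : 'M[R]_(n, m)) :
  entry_continuous (fun=> F).
Proof. by move=> i j t; exact: cvg_cst. Qed.

Lemma entry_continuousD {R : realType} {n m} {F G : R -> 'M[R]_(n, m)} :
  entry_continuous F -> entry_continuous G ->
  entry_continuous (fun t => F t + G t).
Proof.
move=> Fc Gc i j t; under eq_fun do rewrite mxE.
by apply: cvgD; [exact: Fc|exact: Gc].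
Qed.

Lemma entry_continuousZ {R : realType} {n m} {a : R -> R}
    {F : R -> 'M[R]_(n, m)} : continuous a -> entry_continuous F ->
  entry_continuous (fun t => a t *: F t).
Proof.
move=> ac Fc i j t; under eq_fun do rewrite mxE.
by apply: cvgM; [exact: ac|exact: Fc].
Qed.

Lemma entry_continuousM {R : realType} {n m p} {F : R -> 'M[R]_(n, m)}
    {G : R -> 'M[R]_(m, p)} : entry_continuous F -> entry_continuous G ->
  entry_continuous (fun t => F t *m G t).
Proof.
move=> Fc Gc i j; under eq_fun do rewrite mxE.
by apply: continuous_sum => k _ t; apply: cvgM; [exact: Fc|exact: Gc].
Qed.

Lemma entry_continuous_tr {R : realType} {n m} {F : R -> 'M[R]_(n, m)} :
  entry_continuous F -> entry_continuous (fun t => (F t)^T).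
Proof. by move=> Fc i j; under eq_fun do rewrite mxE; exact: Fc. Qed.

Lemma continuous_det {R : realType} {n} {F : R -> 'M[R]_n} :
  entry_continuous F -> continuous (fun t => \det (F t)).
Proof.
move=> Fc; rewrite /determinant; apply: continuous_sum => s _ t.
by apply: cvgM; [exact: cvg_cst|apply: continuous_prod => i _; exact: Fc].
Qed.

Lemma entry_continuous_inv {R : realType} {n} {F : R -> 'M[R]_n} :
  (forall t, F t \in unitmx) -> entry_continuous F ->
  entry_continuous (fun t => invmx (F t)).
Proof.
(* [invmx] is defined by cases; on units it is the adjugate divided by the determinant, and
   cofactors are polynomials in the entries. *)
move=> Fu Fc; under [fun t => invmx _]eq_fun do rewrite /invmx Fu.
apply: entry_continuousZ => [t|i j].
  by apply: cvgV; [rewrite -unitfE -unitmxE|exact: continuous_det].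
under eq_fun do rewrite mxE /cofactor.
move=> t; apply: cvgM; first exact: cvg_cst.
apply: continuous_det => k l; under eq_fun do rewrite !mxE; exact: Fc.
Qed.

(** One neighbourhood serves all [x], because the difference of the forms is controlled by
    [norm1 (K t - K s)], which is continuous in [t] and vanishes at [s]. *)
Lemma quad_form_near {R : realType} {n} {K : R -> 'M[R]_n} (s e : R) :
  entry_continuous K -> 0 < e ->
  \forall t \near s, forall x,
    `|dotv x (K t *m x) - dotv x (K s *m x)| <= e * dotv x x.
Proof.
move=> Kc e0.
have Nc : continuous (fun t => norm1 (K t - K s)).
  rewrite /norm1; do 2!apply: continuous_sum => ? _; move=> t.
  under eq_fun do rewrite !mxE; apply: (@cvg_norm _ R^o).
  by apply: cvgB; [exact: Kc|exact: cvg_cst].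
have N0 : norm1 (K s - K s) = 0.
  by rewrite /norm1; do 2!(rewrite big1 // => ? _); rewrite subrr mxE normr0.
have : \forall t \near s, norm1 (K t - K s) < e.
  by apply: (cvgr_lt _ (Nc s)); rewrite N0.
apply: filterS => t /ltW Kt x; rewrite -dotvBr -mulmxBl.
exact: le_trans (quad_form_le _ _) (ler_wpM2r (dotv_ge0 x) Kt).
Qed.

Lemma pos_def_near {R : realType} {n} {K : R -> 'M[R]_n} (s : R) :
  entry_continuous K -> pos_def (K s) -> \forall t \near s, pos_def (K t).
Proof.
move=> Kc [d d0 Kd]; have d20 : 0 < d / 2 by rewrite divr_gt0.
apply: filterS (quad_form_near s _ Kc d20) => t Kt.
exists (d / 2) => // x; have := Kt x; have := Kd x.
by rewrite ler_norml => ? /andP[]; lra.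
Qed.

(** * Frames on which the form is positive definite, and their local extension *)

Definition good {R : realType} {n m} (H : R -> 'M[R]_n) (t : R)
  (F : 'M[R]_(n, m)) : Prop := pos_def (F^T *m H t *m F).

Lemma entry_continuous_form {R : realType} {n m p} {H : R -> 'M[R]_n}
    (F : 'M[R]_(n, m)) (G : 'M[R]_(n, p)) : entry_continuous H ->
  entry_continuous (fun t => F^T *m H t *m G).
Proof.
move=> Hc; apply: entry_continuousM; last exact: entry_continuous_cst.
by apply: entry_continuousM => //; exact: entry_continuous_cst.
Qed.

(** At time [s] the cross term is nonnegative, so the form on the segment is at least
    [((1 - a)^2 + a^2) * d >= d / 2] times [dotv x x]. Moving each of the three forms by at most
    [d / 8] leaves [d / 4], uniformly in [a]. *)
Lemma good_segment {R : realType} {n m} {H : R -> 'M[R]_n} (s : R)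
    (F G : 'M[R]_(n, m)) :
  entry_continuous H -> (forall t, (H t)^T = H t) ->
  good H s F -> good H s G ->
  (forall x, 0 <= dotv x (F^T *m H s *m G *m x)) ->
  \forall t \near s, forall a, 0 <= a <= 1 -> good H t ((1 - a) *: F + a *: G).
Proof.
move=> Hc Hsym [d1 d10 F1] [d2 d20 G2] FG.
pose d := Num.min d1 d2; have d0 : 0 < d by rewrite lt_min d10 d20.
have dd1 : d <= d1 by rewrite ge_min lexx.
have dd2 : d <= d2 by rewrite ge_min lexx orbT.
have e0 : 0 < d / 8 by rewrite divr_gt0.
have HF := quad_form_near s _ (entry_continuous_form F F Hc) e0.
have HG := quad_form_near s _ (entry_continuous_form G G Hc) e0.
have HFG := quad_form_near s _ (entry_continuous_form F G Hc) e0.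
apply: filterS3 HF HG HFG => t HFt HGt HFGt a /andP[a0 a1].
exists (d / 4) => [|x]; first by rewrite divr_gt0.
move: (HFt x) (HGt x) (HFGt x).
have sym : dotv x (G^T *m H t *m F *m x) = dotv x (F^T *m H t *m G *m x).
  by rewrite dotv_mulmx !trmx_mul trmxK Hsym mulmxA dotvC.
have -> : dotv x (((1 - a) *: F + a *: G)^T *m H t *m
    ((1 - a) *: F + a *: G) *m x) =
  (1 - a) ^+ 2 * dotv x (F^T *m H t *m F *m x) +
  2 * (a * (1 - a)) * dotv x (F^T *m H t *m G *m x) +
  a ^+ 2 * dotv x (G^T *m H t *m G *m x).
  rewrite !(linearD, linearZ) /= !(mulmxDl, =^~ scalemxAl).
  by rewrite !(dotvDr, dotvZr) sym; ring.
move: (dotv_ge0 x) (FG x) (G2 x) (F1 x).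
set f := dotv x (F^T *m H t *m F *m x); set f' := dotv x (_ *m _ *m F *m x).
set g := dotv x (G^T *m H t *m G *m x); set g' := dotv x (G^T *m _ *m _ *m x).
set h := dotv x (F^T *m H t *m G *m x); set h' := dotv x (_ *m _ *m x).
set q := dotv x x => q0 hh hg hf.
rewrite !ler_norml => /andP[f1 _] /andP[g1 _] /andP[h1 _].
have {}hf : d * (7 / 8) * q <= f by nra.
have {}hg : d * (7 / 8) * q <= g by nra.
have {}hh : - (d / 8 * q) <= h by lra.
have := ler_wpM2l (sqr_ge0 (1 - a)) hf; have := ler_wpM2l (sqr_ge0 a) hg.
have a20 : 0 <= 2 * (a * (1 - a)) by rewrite !mulr_ge0 // subr_ge0.
have := ler_wpM2l a20 hh.
have : 0 <= d * q by rewrite mulr_ge0 // ltW.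
have -> : d / 4 * q = (d * q) / 4 by ring.
have -> : d * (7 / 8) * q = (d * q) * (7 / 8) by ring.
have -> : d / 8 * q = (d * q) / 8 by ring.
move: (d * q) => r r0 e1 e2 e3.
(* This square gives [a * (1 - a) <= 1 / 4], while the three bounds add up to
   [(7 / 8 - 2 * a * (1 - a)) * r]. *)
have : 0 <= r * (1 - 2 * a) ^+ 2 by rewrite mulr_ge0 // sqr_ge0.
nra.
Qed.

(** The radius [e] is chosen before [s] and [F]: this uniformity lets an extension pass beyond a
    supremum of reachable times. *)
Definition locally_extendable {R : realType} {n m}
    (Q : R -> 'M[R]_(n, m) -> Prop) : Prop :=
  forall t0, exists2 e : R, 0 < e & forall s F, `|t0 - s| < e -> Q s F ->
    exists2 Phi, entry_continuous Phi /\ Phi s = F &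
      forall t, `|t0 - t| < e -> Q t (Phi t).

Lemma good_locally_extendable {R : realType} {n m} (H : R -> 'M[R]_n) :
  entry_continuous H -> (forall t, (H t)^T = H t) ->
  (forall t, exists W : 'M[R]_(n, m), good H t W) ->
  locally_extendable (@good R n m H).
Proof.
move=> Hc Hsym exW t0; have [W Wgood] := exW t0.
have := pos_def_near t0 (entry_continuous_form W W Hc) Wgood.
move=> /nbhs_ballP[e /= e0 We]; exists e => // s F se Fs.
have [C Cu FC] := ex_unit_psd (F^T *m H s *m W).
(* Congruence by [C] preserves positive definiteness, so [W *m C] is good on the whole ball although
   [C] depends on [s] and [F]. *)
have Ggood t : `|t0 - t| < e -> good H t (W *m C).
  move=> /We Wt; rewrite /good trmx_mul -!mulmxA.
  by have := pos_def_congr Cu Wt; rewrite -!mulmxA.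
have FG x : 0 <= dotv x (F^T *m H s *m (W *m C) *m x).
  by have := FC x; rewrite !mulmxA.
have := good_segment s F (W *m C) Hc Hsym Fs (Ggood s se) FG.
move=> /nbhs_ballP[eta /= eta0 seg].
(* The segment is run through on both sides of [s] while [|s - t| < eta]; afterwards the frame stays
   at [W *m C]. Only [eta] depends on [F]. *)
pose a t := Num.min 1 (`|s - t| / eta).
have ac : continuous a.
  move=> t; apply: (@continuous_min R R (fun=> 1) (fun t => `|s - t| / eta)).
    exact: cvg_cst.
  apply: cvgM; last exact: cvg_cst.
  by apply: (@cvg_norm _ R^o); apply: cvgB; [exact: cvg_cst|exact: cvg_id].
have a01 t : 0 <= a t <= 1.
  by rewrite le_min ler01 ge_min lexx andbT divr_ge0 // ltW.
exists (fun t => (1 - a t) *: F + a t *: (W *m C)).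
  split; last first.
    by rewrite /a subrr normr0 mul0r min_r // subr0 scale1r scale0r addr0.
  apply: entry_continuousD; apply: entry_continuousZ => //;
    try exact: entry_continuous_cst.
  by move=> t; apply: cvgB; [exact: cvg_cst|exact: ac].
move=> t te; case: (ltP `|s - t| eta) => st; first exact: seg.
have -> : a t = 1 by rewrite /a min_l // ler_pdivlMr // mul1r.
by rewrite subrr scale0r add0r scale1r; exact: Ggood.
Qed.

(** * Gluing and extension to the whole line *)

Lemma entry_continuous_comp {R : realType} {n m} {F : R -> 'M[R]_(n, m)}
    {a : R -> R} : continuous a -> entry_continuous F ->
  entry_continuous (fun t => F (a t)).
Proof.
by move=> ac Fc i j t; exact: (cvg_comp a (fun x => F x i j) (ac t) (Fc i j (a t))).
Qed.

Lemma glue {R : realType} {n m} {Phi Psi : R -> 'M[R]_(n, m)} {b : R} :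
  entry_continuous Phi -> entry_continuous Psi -> Phi b = Psi b ->
  exists2 X, entry_continuous X &
    (forall t, t <= b -> X t = Phi t) /\ (forall t, b <= t -> X t = Psi t).
Proof.
move=> Phic Psic PhiPsi.
have minc : continuous (fun t : R => Num.min t b).
  move=> t; apply: (@continuous_min R R id (fun=> b)).
    exact: cvg_id.
  exact: cvg_cst.
have maxc : continuous (fun t : R => Num.max t b).
  move=> t; apply: (@continuous_max R R id (fun=> b)).
    exact: cvg_id.
  exact: cvg_cst.
(* On either side of [b] one of the first two terms is frozen at the common value, which is then
   subtracted; continuity needs no case split. *)
exists (fun t => Phi (Num.min t b) + Psi (Num.max t b) + - Psi b).
  apply: entry_continuousD; last exact: entry_continuous_cst.
  by apply: entry_continuousD; exact: entry_continuous_comp.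
split=> t tb; first by rewrite min_l // max_r // addrK.
by rewrite min_r // max_l // PhiPsi addrAC subrr add0r.
Qed.

(** Continuation argument: if [b] were not reached, the reachable times would be bounded by [b], yet
    local extension around their supremum reaches a later time. *)
Lemma extend_to {R : realType} {n m} {Q : R -> 'M[R]_(n, m) -> Prop} (a b : R)
    (F : 'M[R]_(n, m)) : locally_extendable Q -> a <= b -> Q a F ->
  exists2 Phi, entry_continuous Phi /\ Phi a = F &
    forall t, a <= t <= b -> Q t (Phi t).
Proof.
move=> Qloc ab QF.
pose S := [set c : R | a <= c /\
  exists2 Phi, entry_continuous Phi /\ Phi a = F &
    forall t, a <= t <= c -> Q t (Phi t)].
apply: contrapT => nSb.
have Sa : S a.
  split=> //; exists (fun=> F) => [|t /le_anti <-//].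
  by split=> //; exact: entry_continuous_cst.
have Sub : ubound S b.
  move=> c [ac [Phi Phic Phig]]; rewrite leNgt; apply/negP => bc.
  apply: nSb; exists Phi => // t /andP[at_ tb]; apply: Phig.
  by rewrite at_ (le_trans tb) // ltW.
have Ssup : has_sup S by split; [exists a|exists b].
have [e e0 ext] := Qloc (sup S).
(* The supremum need not be attained, so the extension starts at a reachable [c] within [e] of
   it. *)
have [c Sc] := sup_adherent e0 Ssup.
have cs := ub_le_sup Ssup.2 Sc; case: Sc => ac [Phi [Phic Phia] Phig] ec.
have [|//|Psi [Psic Psia] Psig] := ext c (Phi c).
- by rewrite ger0_norm ?subr_ge0 // ltrBlDr addrC -ltrBlDr.
- by apply: Phig; rewrite ac lexx.
have [X Xc [Xl Xr]] := glue Phic Psic (esym Psia).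
have : S (sup S + e / 2).
  split; first by rewrite (le_trans ac) // (le_trans cs) // lerDl ltW ?divr_gt0.
  exists X => [|t /andP[at_ te]]; first by rewrite Xl.
  case: (leP t c) => tc; first by rewrite Xl //; apply: Phig; rewrite at_.
  rewrite Xr ?ltW //; apply: Psig; rewrite ltr_norml; apply/andP; split; lra.
by move/(ub_le_sup Ssup.2); rewrite gerDl leNgt divr_gt0.
Qed.

(** Extensions are built one unit of time at a time, never altering earlier values, so they
    stabilise at each [t]. *)
Lemma extend_ray {R : realType} {n m} {Q : R -> 'M[R]_(n, m) -> Prop}
    (F : 'M[R]_(n, m)) : locally_extendable Q -> Q 0 F ->
  exists2 Phi, entry_continuous Phi /\ Phi 0 = F &
    forall t, 0 <= t -> Q t (Phi t).
Proof.
move=> Qloc QF.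
pose OK (k : nat) (Phi : R -> 'M[R]_(n, m)) :=
  [/\ entry_continuous Phi, Phi 0 = F & forall t, 0 <= t <= k%:R -> Q t (Phi t)].
(* Stating the property as an implication makes the step total, as [choice] requires; where [OK]
   fails any [Psi] will do. *)
have step (p : nat * (R -> 'M[R]_(n, m))) : exists Psi, OK p.1 p.2 ->
    OK p.1.+1 Psi /\ forall t, t <= p.1%:R -> Psi t = p.2 t.
  case: p => k Phi /=; have [[Phic Phi0 Phig]|nOK] := pselect (OK k Phi);
    last by exists Phi => /nOK.
  have kk : k%:R <= k.+1%:R :> R by rewrite ler_nat.
  have [|Psi [Psic Psik] Psig] := extend_to k%:R k.+1%:R (Phi k%:R) Qloc kk.
    by apply: Phig; rewrite ler0n lexx.
  have [X Xc [Xl Xr]] := glue Phic Psic (esym Psik).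
  exists X => _; split=> //; split=> // [|t /andP[t0 tk]].
    by rewrite Xl // ler0n.
  case: (leP t k%:R) => kt; first by rewrite Xl //; apply: Phig; rewrite t0.
  by rewrite Xr ?ltW //; apply: Psig; rewrite tk ltW.
have [f fP] := choice step.
pose u := fix u k := if k is k'.+1 then f (k', u k') else fun=> F.
have uOK k : OK k (u k).
  elim: k => [|k /(fP (k, u k))[]//]; split=> // [|t /le_anti <-//].
  exact: entry_continuous_cst.
have uS j k t : t <= j%:R -> (j <= k)%N -> u k t = u j t.
  move=> tj; elim: k => [|k IH]; first by rewrite leqn0 => /eqP ->.
  rewrite leq_eqVlt => /predU1P[->//|]; rewrite ltnS => jk; rewrite -IH //.
  have [_ /= ->//] := fP (k, u k) (uOK k).
  by rewrite (le_trans tj) // ler_nat.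
have uE j k t : t <= j%:R -> t <= k%:R -> u j t = u k t.
  by case: (leqP j k) => [|/ltnW] jk tj tk; [rewrite (uS j k)|rewrite (uS k j)].
(* The successor puts [t] strictly below the index, so near each [s] the function [Phi] agrees with
   a single [u k]. *)
pose Phi t := u (Num.truncn t).+1 t.
have tS (t : R) : t <= (Num.truncn t).+1%:R by rewrite ltW // truncnS_gt.
exists Phi => [|t t0]; last first.
  by have [_ _] := uOK (Num.truncn t).+1; apply; rewrite t0 tS.
split; last by have [] := uOK (@Num.truncn R 0).+1.
move=> i j s; have [uc _ _] := uOK (Num.truncn s).+1.
have E : \forall t \near s, u (Num.truncn s).+1 t i j = Phi t i j.
  have : \forall t \near s, t < (Num.truncn s).+1%:R.
    by apply: lt_nbhsl; exact: truncnS_gt.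
  by apply: filterS => t /ltW ts; rewrite (uE _ (Num.truncn t).+1).
exact: (cvg_trans (near_eq_cvg E) (uc i j s : _ --> Phi s i j)).
Qed.

(** The negative half-line is the ray case for the reflected property; the two halves are glued at
    0. *)
Lemma extend_line {R : realType} {n m} {Q : R -> 'M[R]_(n, m) -> Prop}
    (F : 'M[R]_(n, m)) : locally_extendable Q -> Q 0 F ->
  exists2 Phi, entry_continuous Phi & forall t, Q t (Phi t).
Proof.
move=> Qloc QF; have [Phi [Phic Phi0] Phig] := extend_ray F Qloc QF.
have QNloc : locally_extendable (fun t => Q (- t)).
  move=> t0; have [e e0 ext] := Qloc (- t0); exists e => // s G st.
  case/(ext (- s)); first by rewrite -opprD normrN.
  move=> Psi [Psic PsiF] Psig; exists (fun t => Psi (- t)) => [|t tt0].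
    by split=> //; apply: entry_continuous_comp => //; exact: opp_continuous.
  by apply: Psig; rewrite -opprD normrN.
have [|Psi [Psic Psi0] Psig] := extend_ray F QNloc; first by rewrite oppr0.
have [||X Xc [Xl Xr]] := @glue R n m (fun t => Psi (- t)) Phi 0 _ Phic.
- by apply: entry_continuous_comp => //; exact: opp_continuous.
- by rewrite oppr0 Psi0.
exists X => // t; case: (leP t 0) => t0.
  by rewrite Xl // -{1}[t]opprK; apply: Psig; rewrite oppr_ge0.
by rewrite Xr ?ltW //; apply: Phig; exact: ltW.
Qed.

(** * From frames to subspaces *)

Lemma ex_continuous_family {R : realType} {n m} {F : R -> 'M[R]_(n, m)} :
  entry_continuous F -> (forall t, (F t)^T *m F t \in unitmx) ->
  exists U : R -> {vspace 'cV[R]_n}, [/\ continuous_family U,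
    forall t, \dim (U t) = m &
    forall t v, v \in U t -> exists x, v = F t *m x].
Proof.
move=> Fc Fu; pose L t : 'Hom('cV[R]_m, 'cV[R]_n) := linfun (mulmx (F t)).
have LE t x : L t x = F t *m x by rewrite lfunE.
exists (fun t => limg (L t)); split=> [|t|t v /memv_imgP[x _ ->]]; last first.
- by exists x; rewrite LE.
- rewrite limg_dim_eq ?dimvf /dim /= ?muln1 //.
  apply/eqP; rewrite -subv0; apply/subvP => x.
  rewrite memv_cap memv_ker LE memv0 => /andP[_ /eqP Fx0].
  by rewrite -[x](mulKmx (Fu t)) -mulmxA Fx0 !mulmx0.
pose G t := invmx ((F t)^T *m F t).
exists (fun t => F t *m (G t *m (F t)^T)); split=> [t x|].
  split=> [|u /memv_imgP[y _ ->]].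
    by rewrite -mulmxA -LE memv_img ?memvf.
  (* The residual is orthogonal to the column space because the transpose of [F t] annihilates
     it. *)
  rewrite LE dotv_mulmx mulmxBr [X in dotv X _](_ : _ = 0).
    by rewrite dotvC dotvE mulmx0 mxE.
  by rewrite !mulmxA mulmxV // mul1mx subrr.
do 2?[apply: entry_continuousM => //]; last exact: entry_continuous_tr.
apply: entry_continuous_inv => //; apply: entry_continuousM => //.
exact: entry_continuous_tr.
Qed.

(** * Operator norm of a matrix with unit columns *)

Lemma dotv_norm_le {R : realType} {n} (u v : 'cV[R]_n) :
  `|dotv u v| <= (dotv u u + dotv v v) / 2.
Proof.
have := dotv_ge0 (u - v); have := dotv_ge0 (u + v).
rewrite dotvBr dotvDr !(dotvC (_ + _)) !(dotvBr, dotvDr).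
rewrite (dotvC v u) ler_norml => h1 h2.
by apply/andP; split; lra.
Qed.

Lemma enorm_stdbasis {R : realType} {n} (i : 'I_n) : enorm (stdbasis R i) = 1.
Proof.
rewrite /enorm /dotv (bigD1 i) //= big1 => [|j ji]; rewrite !mxE ?eqxx.
  by rewrite mulr1 addr0 sqrtr1.
by rewrite (negPf ji) mulr0.
Qed.

(** The Gram matrix of unit columns has entries at most 1 in absolute value, so its [norm1] is at
    most [n^2]. *)
Lemma unit_cols_bound {R : realType} {n} {A : 'M[R]_n} {x} :
  (forall i, enorm (A *m stdbasis R i) = 1) -> enorm x = 1 ->
  enorm (A *m x) <= n%:R.
Proof.
move=> A1 x1; rewrite -(@ler_pXn2r _ 2) ?nnegrE ?enorm_ge0 ?ler0n //.
rewrite sqr_enorm dotv_mulmx mulmxA dotvC.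
apply: le_trans (le_trans (ler_norm _) (quad_form_le _ _)) _.
rewrite -sqr_enorm x1 expr1n mulr1 /norm1.
have K1 i j : `|(A^T *m A) i j| <= 1.
  have -> : (A^T *m A) i j = dotv (A *m stdbasis R i) (A *m stdbasis R j).
    rewrite mxE; apply: eq_bigr => k _.
    by rewrite /stdbasis -!colE !mxE.
  by apply: (le_trans (dotv_norm_le _ _)); rewrite -!sqr_enorm !A1 expr1n; lra.
apply: (@le_trans _ _ (\sum_(i < n) \sum_(j < n) 1)).
  by do 2![apply: ler_sum => ? _].
by rewrite sumr_const card_ord sumr_const card_ord -mulrnA -natrX mulnn.
Qed.

(** The upper bound, independent of the matrix, makes the set defining [Lambda] bounded, so that its
    [sup] is an upper bound. The lower bound makes [opnorm] positive, for comparing inverses. *)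
Lemma opnorm_itv {R : realType} {n} {A : 'M[R]_n} : (1 <= n)%N ->
  (forall i, enorm (A *m stdbasis R i) = 1) -> 1 <= opnorm A <= n%:R.
Proof.
move=> n1 A1; pose i0 := Ordinal n1; apply/andP; split.
  apply: ub_le_sup.
    by exists n%:R => _ [x x1 <-]; exact: unit_cols_bound.
  by exists (stdbasis R i0); [exact: enorm_stdbasis|exact: A1].
apply: ge_sup => [|_ [x x1 <-]]; last exact: unit_cols_bound.
by exists 1; exists (stdbasis R i0); [exact: enorm_stdbasis|exact: A1].
Qed.

(** * Coordinate inclusions and the excess form *)

Lemma sum_stdbasis {R : realType} {n} (A : 'M[R]_n) (v : 'cV[R]_n) :
  A *m v = \sum_j v j 0 *: (A *m stdbasis R j).
Proof.
apply/matrixP => i j; rewrite ord1 mxE summxE; apply: eq_bigr => k _.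
by rewrite mxE /stdbasis -colE mxE mulrC.
Qed.

Definition incl_mx {R : realType} {n m} (f : 'I_m -> 'I_n) : 'M[R]_(n, m) :=
  \matrix_(i, j) (i == f j)%:R.

Lemma incl_mxK {R : realType} {n m} (f : 'I_m -> 'I_n) : injective f ->
  (incl_mx f)^T *m incl_mx f = 1%:M :> 'M[R]_m.
Proof.
move=> finj; apply/matrixP => j k; rewrite !mxE (bigD1 (f j)) //= big1.
  by rewrite !mxE eqxx mul1r addr0 (inj_eq finj).
by move=> i /negPf ij; rewrite !mxE ij mul0r.
Qed.

Lemma incl_mx_supp {R : realType} {n m} (f : 'I_m -> 'I_n) (s : {set 'I_n})
    (x : 'cV[R]_m) i : (forall j, f j \in s) -> i \notin s ->
  (incl_mx f *m x) i 0 = 0.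
Proof.
move=> fs nis; rewrite mxE big1 // => j _; rewrite mxE.
by case: eqP nis => [->|_]; rewrite ?fs ?mul0r.
Qed.

Definition excess {R : realType} {n} (c : R) (A : 'M[R]_n) : 'M[R]_n :=
  A^T *m A - (c ^+ 2)%:M.

Lemma dotv_excess {R : realType} {n m} (c : R) (A : 'M[R]_n)
    (F : 'M[R]_(n, m)) x :
  dotv x (F^T *m excess c A *m F *m x) =
  enorm (A *m (F *m x)) ^+ 2 - c ^+ 2 * enorm (F *m x) ^+ 2.
Proof.
rewrite -!mulmxA dotv_mulmx trmxK /excess mulmxBl dotvBr -mulmxA dotv_mulmx.
by rewrite trmxK mul_scalar_mx dotvZr !sqr_enorm.
Qed.

(** * Assembly from the Bourgain-Tzafriri sets *)

Theorem theorem1p2 (R : realType) (c0 d0 : R) (hBT : BT_constants c0 d0)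
    (n : nat) (hn : (1 <= n)%N) (A : R -> 'M[R]_n) (hA : mx_continuous A)
    (hcol : forall (t : R) (i : 'I_n), enorm (A t *m stdbasis R i) = 1)
    (Lambda : R) (hLambda : Lambda = sup (range (fun t : R => opnorm (A t))))
    (gamma : R) (hgamma : 0 < gamma < 1) :
  exists (m : nat) (U : R -> {vspace 'cV[R]_n}),
    [/\ d0 * n%:R / (7 * Lambda ^+ 2) <= m%:R,
        continuous_family U,
        forall t : R, \dim (U t) = m &
        forall (t : R) (v : 'cV[R]_n), v \in U t ->
          gamma * c0 * enorm v <= enorm (A t *m v)].
Proof.
have [c00 d00 BT] := hBT; have /andP[g0 g1] := hgamma.
have op t : 1 <= opnorm (A t) <= n%:R := opnorm_itv hn (hcol t).
have opL t : opnorm (A t) <= Lambda.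
  rewrite hLambda; apply: ub_le_sup; last by exists t.
  by exists n%:R => _ [s _ <-]; have /andP[] := op s.
have [s sP] := choice (fun t => BT n (A t) hn (hcol t)).
(* The least cardinality is attained at some [t1]; the lower bound on [m] comes from that time. *)
have [m [t1 t1m] mmin] : exists2 m, (exists t, #|s t| = m) &
    forall t, (m <= #|s t|)%N.
  have ex : exists k, `[<exists t, #|s t| = k>].
    by exists #|s 0|; apply/asboolP; exists 0.
  case: (ex_minnP ex) => m /asboolP mt mmin; exists m => // t.
  by apply: mmin; apply/asboolP; exists t.
pose H t := excess (gamma * c0) (A t).
have Hc : entry_continuous H.
  apply: entry_continuousD; last exact: entry_continuous_cst.
  by apply: entry_continuousM => //; exact: entry_continuous_tr.
have Hsym t : (H t)^T = H t.
  by rewrite /H /excess linearB /= trmx_mul trmxK tr_scalar_mx.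
have exW t : exists W : 'M[R]_(n, m), good H t W.
  (* The first [m] elements of [s t] index the columns of the frame. *)
  pose f (j : 'I_m) : 'I_n := enum_val (widen_ord (mmin t) j).
  have finj : injective f by move=> j k /enum_val_inj /(congr1 val) /= /val_inj.
  have fs j : f j \in s t by exact: enum_valP.
  (* The constant is the gap between [c0^2] and [(gamma * c0)^2], positive as [gamma < 1]. *)
  exists (incl_mx f), (c0 ^+ 2 * (1 - gamma ^+ 2)) => [|x].
    by rewrite mulr_gt0 ?exprn_gt0 // subr_gt0 expr_lt1 // ltW.
  set v := incl_mx f *m x; have vx : enorm v ^+ 2 = dotv x x.
    by rewrite sqr_enorm /v dotv_mulmx mulmxA incl_mxK // mul1mx.
  have vs i : i \notin s t -> v i 0 = 0 by exact: incl_mx_supp.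
  rewrite dotv_excess -/v vx.
  (* Take the coordinates of [v] as scalars: [v] vanishes off [s t], so the sums over [s t] are full
     sums. *)
  have [_ /(_ (fun j => v j 0))] := sP t.
  have -> : \sum_(j in s t) `|v j 0| ^+ 2 = dotv v v.
    rewrite [RHS](bigID (mem (s t))) /= [X in _ + X]big1 ?addr0.
      by apply: eq_bigr => j _; rewrite real_normK ?num_real // expr2.
    by move=> j /vs ->; rewrite mul0r.
  have -> : \sum_(j in s t) v j 0 *: (A t *m stdbasis R j) = A t *m v.
    rewrite [RHS]sum_stdbasis [RHS](bigID (mem (s t))) /=.
    by rewrite [X in _ + X]big1 ?addr0 // => j /vs ->; rewrite scale0r.
  rewrite -/(enorm v) => cv.
  have : (c0 * enorm v) ^+ 2 <= enorm (A t *m v) ^+ 2.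
    by rewrite ler_pXn2r // ?nnegrE ?mulr_ge0 ?enorm_ge0 // ltW.
  by rewrite !exprMn vx; lra.
have [W0 W0good] := exW 0.
have [F Fc Fgood] :=
  extend_line W0 (good_locally_extendable H Hc Hsym exW) W0good.
have Fu t : (F t)^T *m F t \in unitmx.
  (* A kernel vector of the Gram matrix has [F t *m x = 0], so the positive definite form vanishes
     at it. *)
  apply: unitmx_ker0 => x FFx; apply: (pos_def_ker (Fgood t)).
  suff Fx : F t *m x = 0 by rewrite -mulmxA Fx mulmx0 dotvE mulmx0 mxE.
  apply/eqP; rewrite -dotv_eq0.
  by rewrite dotv_mulmx mulmxA FFx dotvC dotvE mulmx0 mxE.
have [U [Uc Udim Uv]] := ex_continuous_family Fc Fu.
exists m, U; split=> // [|t _ /Uv[x ->]]; last first.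
  have [d dd0 /(_ x)] := Fgood t; rewrite dotv_excess => Fx.
  have gc0 : 0 <= gamma * c0 by rewrite mulr_ge0 ?ltW.
  rewrite -(@ler_pXn2r _ 2) ?nnegrE ?(mulr_ge0 gc0) ?enorm_ge0 // exprMn.
  by rewrite -subr_ge0 (le_trans _ Fx) // mulr_ge0 ?dotv_ge0 ?ltW.
(* At [t1] the cardinality is [m]; it remains to compare denominators, using
   [opnorm (A t1) <= Lambda] and [1 <= 7]. *)
have [+ _] := sP t1; rewrite t1m; apply: le_trans.
have /andP[o1 _] := op t1; have o0 := lt_le_trans ltr01 o1.
have L0 := lt_le_trans o0 (opL t1).
apply: ler_wpM2l; first by rewrite mulr_ge0 ?ler0n ?(ltW d00).
rewrite lef_pV2 ?posrE ?mulr_gt0 ?exprn_gt0 //.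
apply: (@le_trans _ _ (Lambda ^+ 2)).
  by rewrite ler_pXn2r ?nnegrE ?(ltW o0) ?(ltW L0) ?opL.
by rewrite ler_peMl ?sqr_ge0 // ler1n.
Qed.
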